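(* There is an absolute constant $C>0$ such that the following holds. Let $k,l\ge 2$, let $Q$ be an $l$-permutation matrix with $c_Q\ge 3$, let $P$ be a $k$-permutation matrix, and let $R=P\# Q$. Then \[ c_R \le 2^{C k\log^2(c_Q k)}. \]
   Context: A $k$-permutation matrix is a $k\times k$ binary matrix with exactly one $1$-entry in every row and column. If $P$ is a $k$-permutation matrix with $1$-entries at $(i,\pi(i))$, $i\in[k]$, and $Q$ is an $l$-permutation matrix with $1$-entries at $(j,\rho(j))$, $j\in[l]$, the grid product $P\# Q$ is the $kl$-permutation matrix with $1$-entries exactly at the positions $((j-1)k+i,\ (\pi(i)-1)l+\rho(j))$ for $i\in[k]$, $j\in[l]$. A binary matrix $A$ contains $B$ if $B$ can be obtained from $A$ by deleting some rows, some columns, and changing some $1$-entries to $0$-entries; otherwise $A$ avoids $B$. $\mathrm{ex}(n,P)$ is the maximum number of $1$-entries in an $n\times n$ binary matrix avoiding $P$, and $c_P=\lim_{n\to\infty}\mathrm{ex}(n,P)/n$ (this limit exists and is finite). Logarithms are base $2$. *)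

(* Defs.v *)
From mathcomp Require Import all_boot all_order all_algebra.
From mathcomp Require Import all_classical all_reals all_analysis.

Set Implicit Arguments.
Unset Strict Implicit.
Unset Printing Implicit Defensive.

Import Order.TTheory GRing.Theory Num.Theory.
Import numFieldTopology.Exports numFieldNormedType.Exports.

Local Open Scope classical_set_scope.
Local Open Scope ring_scope.

Definition permutation_matrix (k : nat) (P : 'M[bool]_k) : Prop :=
  (forall i : 'I_k, exists! j : 'I_k, P i j) /\
  (forall j : 'I_k, exists! i : 'I_k, P i j).

(* With 0-based indices, the 1-entries (i, a) of P and (j, b) of Q produce
   the 1-entry (j k + i, a l + b). *)
Definition grid_product (k l : nat) (P : 'M[bool]_k) (Q : 'M[bool]_l) :
    'M[bool]_(k * l) :=
  \matrix_(r, c)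
    [exists i : 'I_k, exists a : 'I_k, exists j : 'I_l, exists b : 'I_l,
      [&& P i a, Q j b, r == (j * k + i)%N :> nat
        & c == (a * l + b)%N :> nat]].

(* The strictly increasing maps f and g list the rows and columns of A that
   are kept. *)
Definition contains (m n p q : nat) (A : 'M[bool]_(m, n))
    (B : 'M[bool]_(p, q)) : Prop :=
  exists (f : 'I_p -> 'I_m) (g : 'I_q -> 'I_n),
    [/\ {homo f : i j / (i < j)%N},
        {homo g : i j / (i < j)%N}
      & forall i j, B i j -> mxsub f g A i j].

Definition avoids (m n p q : nat) (A : 'M[bool]_(m, n))
    (B : 'M[bool]_(p, q)) : Prop :=
  ~ contains A B.

Definition weight (m n : nat) (A : 'M[bool]_(m, n)) : nat :=
  #|[set ij : 'I_m * 'I_n | A ij.1 ij.2]%SET|.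

Definition ex (n k : nat) (P : 'M[bool]_k) : nat :=
  \max_(A : 'M[bool]_n | `[< avoids A P >]) weight A.

(* The term n = 0 is irrelevant to the limit. *)
Definition limit_const (R : realType) (k : nat) (P : 'M[bool]_k) : R :=
  limn (fun n => (ex n P)%:R / n%:R : R).

Definition log2 (R : realType) (x : R) : R := ln x / ln 2.

(* Main.v *)
(* Write [R = P # Q]. As in the Marcus-Tardos argument, the weight of an
   [R]-avoiding matrix is linear with constant [8 N q], where [q = 4 s^2] and
   no [R]-avoiding matrix with [q] columns has [N] rows of weight at least
   [s]; the same is needed for the transpose of [R].

   Let [b > 2 c_Q], [s = k b] and [B = 2 k b]. Group [B^(d+1)] rows into [B]
   blocks of [B^d] rows. If each block occupies all but a fraction about
   [1/(8k)] of the columns occupied by their union, cut these columns into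
   [k b] cells of equal size: each block misses few cells. Label the blocks by
   [2k x b] and the cells by [k x b]. Averaging over [k] shifts [c] gives a
   [c] for which at least half of the pairs [(r, y)] satisfy: for all [i],
   block [(c + i, r)] meets cell [(pi i, y)]. These pairs form a [b x b] matrix
   that contains [Q], which yields [R]. Whether blocks and cells are
   ordered lexicographically with the [k]- or the [b]-coordinate first is
   irrelevant, so that [R] and its transpose are treated at once.

   Otherwise some block occupies fewer columns than the union by a factor
   [1 + 1/(8k)]. Hence in the absence of [R] the number of occupied columns of
   [B^d] rows grows at least like [(1 + 1/(8k))^d]; it is at most [q], so
   [N = B^O(k log q)] suffices. *)
Require Import Defs.
From mathcomp Require Import all_boot all_order all_algebra.
From mathcomp Require Import all_classical all_reals all_analysis.
From mathcomp Require Import zify ring lra.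

Import Order.TTheory GRing.Theory Num.Theory.
Import numFieldTopology.Exports numFieldNormedType.Exports.
Local Open Scope nat_scope.

(** * Patterns in infinite binary matrices *)

(** [E] indexes the 1-entries of the pattern, which is given only by how their rows and their
    columns compare. Indices are natural numbers, so that matrices can be cut into blocks of any
    size. *)
Definition has_pattern {E : Type} (ltr ltc : rel E) (A : nat -> nat -> bool) :=
  exists u v : E -> nat,
    [/\ forall e, A (u e) (v e),
        forall e e', ltr e e' -> u e < u e'
      & forall e e', ltc e e' -> v e < v e'].

Definition separated (F : nat -> nat -> Prop) :=
  forall x x' a a', x < x' -> F x a -> F x' a' -> a < a'.

Lemma has_pattern_tr E (ltr ltc : rel E) A :
  has_pattern ltr ltc A -> has_pattern ltc ltr (fun x y => A y x).
Proof. by case=> u [v [H1 H2 H3]]; exists v, u. Qed.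

(** [F x a] puts row [a] of [A] into the group contracted to row [x] of [B], and [G] does the same
    for columns. One 1-entry chosen for each entry of the pattern lifts a copy from [B] to [A]. *)
Lemma has_pattern_minor E (ltr ltc : rel E) (A B : nat -> nat -> bool)
    (F G : nat -> nat -> Prop) :
  separated F -> separated G ->
  (forall x y, B x y -> exists a b, [/\ F x a, G y b & A a b]) ->
  has_pattern ltr ltc B -> has_pattern ltr ltc A.
Proof.
move=> sF sG BA [u [v [Huv Hu Hv]]].
have /choice [w Hw] : forall e, exists ab : nat * nat,
    [/\ F (u e) ab.1, G (v e) ab.2 & A ab.1 ab.2].
  by move=> e; have [a [b H]] := BA _ _ (Huv e); exists (a, b).
exists (fun e => (w e).1), (fun e => (w e).2); split=> [e|e e' lt_e|e e' lt_e].
- by case: (Hw e).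
- have [Fe _ _] := Hw e; have [Fe' _ _] := Hw e'.
  exact: sF (Hu _ _ lt_e) Fe Fe'.
- have [_ Ge _] := Hw e; have [_ Ge' _] := Hw e'.
  exact: sG (Hv _ _ lt_e) Ge Ge'.
Qed.

(** * Averaging over shifts *)

(* For distinct [c] the cells [(c + alpha i, gamma i)] are distinct, so the sum
   over [c] of the bounded quantities is at most the number of all misses. *)
Lemma exists_good_shift (k b : nat) (alpha gamma : 'I_k -> 'I_k)
    (miss : nat -> nat -> nat -> nat -> bool) :
  0 < k -> injective gamma ->
  (forall p r, p < k.*2 -> r < b ->
     4 * (\sum_(a < k) \sum_(y < b) miss p r a y) <= b) ->
  exists2 c, c < k &
    2 * (\sum_(r < b) \sum_(y < b)
           [exists i, miss (c + alpha i) r (gamma i) y]) <= b * b.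
Proof.
move=> k_gt0 inj_g Hm.
pose W c := \sum_(r < b) \sum_(y < b) [exists i, miss (c + alpha i) r (gamma i) y].
have [[c Hc]|H] := pselect (exists c : 'I_k, 2 * W c <= b * b).
  by exists c.
have {}H c : c < k -> b * b < 2 * W c.
  by move=> ltc; rewrite ltnNge; apply/negP => Hc; apply: H; exists (Ordinal ltc).
have gbij : bijective gamma by apply: injF_bij.
have W_le : \sum_(c < k) W c <=
    \sum_(p < k.*2) \sum_(r < b) \sum_(a < k) \sum_(y < b) miss p r a y.
  rewrite /W exchange_big /= [leqRHS]exchange_big /=.
  apply: leq_sum => r _.
  rewrite exchange_big /= (eq_bigr (fun p : 'I_k.*2 =>
     \sum_(y < b) \sum_(a < k) miss p r a y)); last first.
    by move=> p _; rewrite exchange_big.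
  rewrite [leqRHS]exchange_big /=; apply: leq_sum => y _.
  apply: (@leq_trans (\sum_(c < k) \sum_(i < k) miss (c + alpha i) r (gamma i) y)).
    apply: leq_sum => c _; case: existsP => // -[i Hi].
    by rewrite (bigD1 i) //= Hi.
  rewrite exchange_big /= [leqRHS]exchange_big /=.
  rewrite [leqRHS](reindex gamma) /=; last exact: onW_bij.
  apply: leq_sum => i _.
  (* For fixed [i] the labels [c + alpha i] fill a window of length [k], starting at [alpha i],
     among the [2k] labels; the terms outside it are dropped. *)
  rewrite -(big_mkord xpredT (fun p => nat_of_bool (miss p r (gamma i) y))).
  have lt_a := ltn_ord (alpha i).
  rewrite (@big_cat_nat _ _ _ (alpha i)) //=; last by lia.
  rewrite (@big_cat_nat _ _ _ (alpha i + k) (alpha i)) //=; [|lia|lia].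
  rewrite addnCA.
  apply: leq_trans (leq_addr _ _).
  rewrite -{1}[X in index_iota X _]add0n big_addn addKn big_mkord.
  by apply: eq_leq; apply: eq_bigr.
have : k * (b * b) < 2 * \sum_(c < k) W c.
  rewrite big_distrr /=.
  have -> : k * (b * b) = \sum_(c < k) (b * b) by rewrite sum_nat_const card_ord.
  case: k k_gt0 {alpha gamma inj_g Hm gbij W_le} W H => // k _ W H.
  rewrite !big_ord_recl -addSn; apply: leq_add; first exact: H.
  by apply: leq_sum => i _; apply/ltnW/H.
(* If every shift failed, there would be more than [k * b * b / 2] misses in all. *)
have : 4 * (\sum_(p < k.*2) \sum_(r < b) \sum_(a < k) \sum_(y < b) miss p r a y)
    <= k.*2 * (b * b).
  have -> : k.*2 * (b * b) = \sum_(p < k.*2) \sum_(r < b) b.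
    by rewrite !sum_nat_const !card_ord.
  by do 2![rewrite big_distrr /=; apply: leq_sum => ? _]; apply: Hm.
nia.
Qed.

(** * Cells missed by a block of rows *)

Lemma sum_bool_count (q : nat) (P : pred nat) :
  \sum_(y < q) P y = count P (iota 0 q).
Proof.
rewrite -(big_mkord xpredT (fun y => nat_of_bool (P y))) -sum1_count.
rewrite [RHS]big_mkcond /= /index_iota subn0.
by apply: eq_bigr => y _; case: (P y).
Qed.

Definition hit (P : pred nat) (S : seq nat) (r z : nat) :=
  [exists c : 'I_r, P (nth 0 S (z * r + c))].

(** A missed cell is a stretch of [r] members of [S] outside [P], and distinct cells are
    disjoint. *)
Lemma missed_cells (P : pred nat) (S : seq nat) (r m : nat) :
  m * r <= size S ->
  r * (\sum_(z < m) ~~ hit P S r z) <= count (predC P) S.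
Proof.
move=> le_mr.
apply: (@leq_trans (count (predC P) (take (m * r) S))); last first.
  by rewrite -{2}(cat_take_drop (m * r) S) count_cat leq_addr.
elim: m le_mr => [|m IH] le_mr; first by rewrite big_ord0 muln0.
rewrite big_ord_recr /= mulnDr.
rewrite mulSnr takeD count_cat; apply: leq_add; first by apply: IH; lia.
case: (boolP (hit _ _ _ _)) => [_|miss]; first by rewrite muln0.
rewrite muln1; set T := take r _.
have sT : size T = r by rewrite /T size_takel // size_drop; lia.
suff : all (predC P) T by rewrite all_count sT => /eqP ->.
apply/(all_nthP 0) => c; rewrite sT => lt_c.
rewrite /T nth_take // nth_drop /=; apply: contra miss => Pc.
by apply/existsP; exists (Ordinal lt_c).
Qed.

Definition occupied (A : nat -> nat -> bool) (x n : nat) : pred nat :=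
  fun y => [exists t : 'I_n, A (x + t) y].

Definition occupancy (A : nat -> nat -> bool) (q x n : nat) :=
  count (occupied A x n) (iota 0 q).


(** * Lexicographic labels *)

(* Rows of [P # Q] are ordered by [lex false] and columns by [lex true]; the
   transpose exchanges them. *)
Definition lex (b : bool) {k l : nat} (alpha : 'I_k -> 'I_k)
    (beta : 'I_l -> 'I_l) : rel ('I_k * 'I_l) :=
  fun e e' =>
    if b then (alpha e.1 < alpha e'.1) ||
              (alpha e.1 == alpha e'.1) && (beta e.2 < beta e'.2)
    else (beta e.2 < beta e'.2) ||
         (beta e.2 == beta e'.2) && (alpha e.1 < alpha e'.1).

(** The rank of [(p, r)] among the pairs with [p < m] and [r < n], with the same choice of leading
    coordinate as in [lex]. *)
Definition idx (b : bool) (m n p r : nat) := if b then p * n + r else r * m + p.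

Lemma idx_bound b m n p r : p < m -> r < n -> idx b m n p r < m * n.
Proof. by case: b => /=; nia. Qed.

Lemma sum_idx b m n (F : nat -> nat) :
  \sum_(p < m) \sum_(r < n) F (idx b m n p r) = \sum_(z < m * n) F z.
Proof.
have aux m' n' : \sum_(p < m') \sum_(r < n') F (p * n' + r) = \sum_(z < m' * n') F z.
  elim: m' => [|m' IH]; first by rewrite !big_ord0.
  rewrite big_ord_recr /= IH mulSnr -!(big_mkord xpredT F).
  rewrite (@big_cat_nat _ _ _ (m' * n') 0 (m' * n' + n')) ?leq_addr //=.
  congr (_ + _); have := @big_addn nat 0 addn 0 (m' * n' + n') (m' * n') xpredT F.
  rewrite add0n addKn big_mkord => ->.
  by apply: eq_bigr => i _; rewrite addnC.
by case: b => /=; rewrite ?aux // exchange_big /= aux mulnC.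
Qed.

(** The bounds [c + k <= m] and [f j < n] exclude a carry from the minor into the leading
    coordinate, so the shift by [c] preserves the order. *)
Lemma idx_lex b {k l : nat} (alpha : 'I_k -> 'I_k) (beta : 'I_l -> 'I_l)
    (m n c : nat) (f : 'I_l -> nat) e e' :
  c + k <= m -> (forall j, f j < n) ->
  (forall j j', beta j < beta j' -> f j < f j') ->
  (forall j j', beta j = beta j' -> f j = f j') ->
  lex b alpha beta e e' ->
  idx b m n (c + alpha e.1) (f e.2) < idx b m n (c + alpha e'.1) (f e'.2).
Proof.
move=> le_m f_lt f_homo f_eq; have := f_lt e.2; have := f_lt e'.2.
have := ltn_ord (alpha e.1); have := ltn_ord (alpha e'.1).
case: b => /=; rewrite /lex /idx => lt1 lt2 lt3 lt4 /orP[lt_e|/andP[/eqP eq_e lt_e]].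
- nia.
- by have := f_homo _ _ lt_e; rewrite eq_e; lia.
- have := f_homo _ _ lt_e; nia.
- by rewrite (f_eq _ _ eq_e); lia.
Qed.

(** * The grid product in interleaved blocks *)

(** The density property of [Q]: a [b] by [b] matrix at least half full contains it. Giving [Q] by
    two orders makes this symmetric under transposition. *)
Definition forces (b : nat) {l : nat} (beta delta : 'I_l -> 'I_l) :=
  forall M : nat -> nat -> bool,
    b * b <= 2 * (\sum_(r < b) \sum_(y < b) M r y) ->
    has_pattern (fun j j' => beta j < beta j') (fun j j' => delta j < delta j')
      (fun r y => [&& r < b, y < b & M r y]).

(** The case in which each block occupies more than the fraction [8k / (8k + 1)] of the columns
    occupied by the union. *)
Lemma interleaved_pattern (k l b : nat) (alpha gamma : 'I_k -> 'I_k)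
    (beta delta : 'I_l -> 'I_l) (rb cb : bool)
    (A : nat -> nat -> bool) (q x n : nat) :
  0 < k -> 0 < b -> injective gamma -> injective beta -> injective delta ->
  forces b beta delta ->
  k * b <= occupancy A q x (k.*2 * b * n) ->
  (forall t, t < k.*2 * b ->
     occupancy A q x (k.*2 * b * n) * (8 * k)
       < (8 * k).+1 * occupancy A q (x + t * n) n) ->
  has_pattern (lex rb alpha beta) (lex cb gamma delta) A.
Proof.
move=> k_gt0 b_gt0 inj_g inj_b inj_d HQ big loss.
set Y := occupied A x (k.*2 * b * n).
pose S := [seq y <- iota 0 q | Y y].
have sS : size S = occupancy A q x (k.*2 * b * n) by rewrite size_filter.
have S_lt z z' : z < z' -> z' < size S -> nth 0 S z < nth 0 S z'.
  move=> lt_z lt_z'; apply: (sorted_ltn_nth ltn_trans) => //.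
  - by apply: (sorted_filter ltn_trans); apply: iota_ltn_sorted.
  - by rewrite inE; lia.
set r' := size S %/ (k * b).
have r'_gt0 : 0 < r' by rewrite divn_gt0 ?muln_gt0 ?k_gt0 // sS.
have le_S : k * b * r' <= size S by rewrite mulnC leq_trunc_div.
(* Since [r' >= 1], rounding the cell size down leaves less than half of [S] uncovered. *)
have lt_S : size S < 2 * (k * b * r').
  have kb_gt0 : 0 < k * b by rewrite muln_gt0 k_gt0.
  have := ltn_ceil (size S) kb_gt0; rewrite -/r'; nia.
pose occ t := occupied A (x + t * n) n.
pose B t z := [&& t < k.*2 * b, z < k * b & hit (occ t) S r' z].
(* A block misses fewer than [size S / (8k + 1)] columns of [S], hence fewer than [b * r' / 4], and
   each missed cell accounts for [r'] of them. *)
have missB t : t < k.*2 * b -> 4 * (\sum_(z < k * b) ~~ B t z) <= b.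
  move=> lt_t; have := loss _ lt_t; rewrite -sS => lt_occ.
  have := @missed_cells (occ t) S r' (k * b) le_S.
  have -> : \sum_(z < k * b) ~~ hit (occ t) S r' z = \sum_(z < k * b) ~~ B t z.
    by apply: eq_bigr => z _; rewrite /B lt_t ltn_ord.
  have := count_predC (occ t) S.
  have -> : count (occ t) S = occupancy A q (x + t * n) n.
    rewrite /S count_filter; apply: eq_count => y /=.
    apply/andb_idr => /existsP[i Hi]; apply/existsP.
    have lt_i : t * n + i < k.*2 * b * n by have := ltn_ord i; nia.
    by exists (Ordinal lt_i); rewrite /= addnA.
  move=> cS le_miss; rewrite leqNgt; apply/negP => lt_b.
  nia.
have [|c lt_c Hc] := @exists_good_shift k b alpha gamma
  (fun p r a y => ~~ B (idx rb k.*2 b p r) (idx cb k b a y)) k_gt0 inj_g.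
  move=> p r lt_p lt_r.
  rewrite (sum_idx cb k b (fun z => ~~ B (idx rb k.*2 b p r) z : nat)).
  by apply: missB; apply: idx_bound.
(* A 1-entry of [M] supplies a whole copy of the [k]-pattern; the good shift makes [M] at least half
   full. *)
pose M r y := [forall i, B (idx rb k.*2 b (c + alpha i) r) (idx cb k b (gamma i) y)].
have [|f [g [HM Hf Hg]]] := HQ M.
  have : \sum_(r < b) \sum_(y < b) M r y + \sum_(r < b) \sum_(y < b)
      [exists i, ~~ B (idx rb k.*2 b (c + alpha i) r) (idx cb k b (gamma i) y)] = b * b.
    have -> : b * b = \sum_(r < b) \sum_(y < b) 1.
      by rewrite !sum_nat_const !card_ord muln1.
    rewrite -big_split; apply: eq_bigr => r _; rewrite -big_split.
    by apply: eq_bigr => y _; rewrite /M -negb_forall /= addnC addn_negb.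
  lia.
(* [B] contracts each block of rows and each cell of columns to a single index. *)
apply: (@has_pattern_minor _ _ _ _ B
  (fun t a => x + t * n <= a < x + t.+1 * n)
  (fun z y => exists2 c : nat, c < r' & z * r' + c < size S /\ y = nth 0 S (z * r' + c))).
- move=> t t' a a' lt_t; nia.
- move=> z z' a a' lt_z [d lt_d [_ ->]] [d' lt_d' [lt_s ->]].
  by apply: S_lt => //; nia.
- move=> t z /and3P[lt_t lt_z /existsP[d /existsP[i Hi]]].
  exists (x + t * n + i), (nth 0 S (z * r' + d)); split=> //.
  + have lt_i : i < n := ltn_ord i; nia.
  + have lt_d : d < r' := ltn_ord d.
    by exists (nat_of_ord d) => //; split=> //; nia.
(* Only the row labels are shifted; the summand [0] brings the column labels into the form of
   [idx_lex]. *)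
exists (fun e => idx rb k.*2 b (c + alpha e.1) (f e.2)),
       (fun e => idx cb k b (0 + gamma e.1) (g e.2)); split.
- by move=> e; have /and3P[_ _ /forallP] := HM e.2; apply.
- move=> e e'; apply: idx_lex => //; first by lia.
  + by move=> j; case/and3P: (HM j).
  + by move=> j j' /inj_b ->.
- move=> e e'; apply: idx_lex => //.
  + by move=> j; case/and3P: (HM j).
  + by move=> j j' /inj_d ->.
Qed.

(** * Growth of the number of occupied columns *)

Lemma count_row_occupancy A q x n t :
  t < n -> count (A (x + t)) (iota 0 q) <= occupancy A q x n.
Proof.
by move=> lt_t; apply: sub_count => y Ay; apply/existsP; exists (Ordinal lt_t).
Qed.

(** Induction on [d]: if the union violated the bound while all its blocks satisfy theirs, every
    block would occupy nearly all columns of the union, and [interleaved_pattern] would give a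
    copy. *)
Lemma occupancy_growth {k l b : nat} {alpha gamma : 'I_k -> 'I_k}
    {beta delta : 'I_l -> 'I_l} {rb cb : bool} {A : nat -> nat -> bool} (q : nat) :
  0 < k -> 0 < b -> injective gamma -> injective beta -> injective delta ->
  forces b beta delta ->
  ~ has_pattern (lex rb alpha beta) (lex cb gamma delta) A ->
  forall d x,
    (forall t, t < (k.*2 * b) ^ d -> k * b <= count (A (x + t)) (iota 0 q)) ->
    k * b * (8 * k).+1 ^ d <= occupancy A q x ((k.*2 * b) ^ d) * (8 * k) ^ d.
Proof.
move=> k_gt0 b_gt0 inj_g inj_b inj_d HQ noA.
have B_gt0 : 0 < k.*2 * b by rewrite muln_gt0 double_gt0 k_gt0.
elim=> [|d IH] x rich.
  rewrite !expn0 !muln1; apply: leq_trans (rich 0 _) _ => //.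
  exact: count_row_occupancy.
rewrite leqNgt; apply/negP => small; apply: noA.
apply: (@interleaved_pattern k l b alpha gamma beta delta rb cb A q x
          ((k.*2 * b) ^ d)) => //.
  rewrite -expnS; apply: leq_trans (rich 0 _) _; first by rewrite expn_gt0 B_gt0.
  by apply: count_row_occupancy; rewrite expn_gt0 B_gt0.
rewrite -expnS => t lt_t.
set o := occupancy _ _ (x + _) _; set O := occupancy _ _ x _ in small *.
have {}IH : k * b * (8 * k).+1 ^ d <= o * (8 * k) ^ d.
  apply: IH => t' lt_t'; rewrite -addnA; apply: rich.
  by rewrite expnS; nia.
have p_gt0 : 0 < (8 * k) ^ d by rewrite expn_gt0 muln_gt0 k_gt0.
rewrite -(ltn_pmul2r p_gt0).
move: small; rewrite !expnS; nia.
Qed.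

(** The first two terms of the binomial expansion of [(n + 1) ^ n] both equal [n ^ n]. *)
Lemma exp_succ_ge2 n : 0 < n -> 2 * n ^ n <= n.+1 ^ n.
Proof.
case: n => // n _.
suff H m : n.+1 ^ m + m * n.+1 ^ m.-1 <= n.+2 ^ m.
  by apply: leq_trans _ (H n.+1); rewrite /= expnS; lia.
elim: m => [|m IH] //; rewrite [leqRHS]expnS.
apply: leq_trans _ (leq_mul (leqnn n.+2) IH).
case: m {IH} => [|m] //=; first by rewrite !expn1 expn0; lia.
by rewrite !expnS; nia.
Qed.

(** Every [8k] levels at least double the lower bound on the occupancy, so [8 * k * m] levels
    without a sparse row would need [2 ^ m > q] columns. *)
Lemma sparse_row (k l b m q : nat) (alpha gamma : 'I_k -> 'I_k)
    (beta delta : 'I_l -> 'I_l) (rb cb : bool) (A : nat -> nat -> bool) :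
  0 < k -> 0 < b -> injective gamma -> injective beta -> injective delta ->
  forces b beta delta -> q < 2 ^ m ->
  ~ has_pattern (lex rb alpha beta) (lex cb gamma delta) A ->
  exists2 t, t < (k.*2 * b) ^ (8 * k * m) & count (A t) (iota 0 q) < k * b.
Proof.
move=> k_gt0 b_gt0 inj_g inj_b inj_d HQ lt_q noA.
have [[t [H1 H2]]|H] := pselect (exists t,
    t < (k.*2 * b) ^ (8 * k * m) /\ count (A t) (iota 0 q) < k * b).
  by exists t.
exfalso.
set o := occupancy A q 0 ((k.*2 * b) ^ (8 * k * m)).
have growth : k * b * (8 * k).+1 ^ (8 * k * m) <= o * (8 * k) ^ (8 * k * m).
  apply: (occupancy_growth q k_gt0 b_gt0 inj_g inj_b inj_d HQ noA) => t lt_t.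
  by rewrite leqNgt; apply/negP => ?; apply: H; exists t.
have le_o : o <= q by rewrite /o /occupancy -{2}(size_iota 0 q) count_size.
have k8_gt0 : 0 < 8 * k by rewrite muln_gt0 k_gt0.
have p_gt0 : 0 < (8 * k) ^ (8 * k * m) by rewrite expn_gt0 k8_gt0.
have : 2 ^ m * (8 * k) ^ (8 * k * m) <= (8 * k).+1 ^ (8 * k * m).
  rewrite !(expnM _ (8 * k) m) -expnMn; case: (posnP m) => [->|m_gt0] //.
  by rewrite leq_exp2r ?exp_succ_ge2.
set Z := (8 * k).+1 ^ _ in growth *; set p := (8 * k) ^ _ in growth p_gt0 *.
move=> le_Z.
have : Z <= k * b * Z by rewrite leq_pmull // muln_gt0 k_gt0.
have : o * p < 2 ^ m * p by rewrite ltn_pmul2r //; lia.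
lia.
Qed.

(** * The Marcus-Tardos recursion *)

Definition mass (m n : nat) (A : nat -> nat -> bool) :=
  \sum_(x < m) \sum_(y < n) A x y.

Lemma sum_blocks n' q (F : nat -> nat) :
  \sum_(z < n' * q) F z = \sum_(x < n') \sum_(a < q) F (x * q + a).
Proof. by rewrite -(sum_idx true). Qed.

Lemma separated_blocks q : separated (fun x a => x * q <= a < x.+1 * q).
Proof. by move=> x x' a a' lt_x; nia. Qed.

Definition contract (q : nat) (A : nat -> nat -> bool) (x y : nat) :=
  [exists a : 'I_q, exists b : 'I_q, A (x * q + a) (y * q + b)].

Lemma contractP q (A : nat -> nat -> bool) x y :
  reflect (exists a b, [/\ x * q <= a < x.+1 * q, y * q <= b < y.+1 * q & A a b])
    (contract q A x y).
Proof.
apply: (iffP existsP) => [[a /existsP[b Aab]]|[a [b [Ha Hb Aab]]]].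
  exists (x * q + a), (y * q + b); split=> //.
  - have lt_a : a < q := ltn_ord a; nia.
  - have lt_b : b < q := ltn_ord b; nia.
have lt_a : a - x * q < q by nia.
have lt_b : b - y * q < q by nia.
exists (Ordinal lt_a); apply/existsP; exists (Ordinal lt_b) => /=.
by rewrite !subnKC //; [case/andP: Hb|case/andP: Ha].
Qed.

(** The wide blocks of Marcus and Tardos; for the transpose, with [x] and [y] exchanged, these are
    the tall blocks. *)
Definition wide (q s : nat) (A : nat -> nat -> bool) (x y : nat) :=
  s <= count (fun b => [exists a : 'I_q, A (x * q + a) (y * q + b)]) (iota 0 q).

(** Contracting each wide block of block column [y] to one row gives rows of weight at least [s];
    more than [N] of them contradict the sparse row. *)
Lemma wide_blocks (E : Type) (ltr ltc : rel E) (N q s : nat) (A : nat -> nat -> bool) :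
  (forall A, ~ has_pattern ltr ltc A ->
     exists2 t, t < N & count (A t) (iota 0 q) < s) ->
  ~ has_pattern ltr ltc A ->
  forall n y, \sum_(x < n) wide q s A x y <= N.
Proof.
move=> sparse noA n y; rewrite (sum_bool_count n (fun x => wide q s A x y)).
set W := fun x => wide q s A x y; rewrite -size_filter.
set L := [seq x <- iota 0 n | W x]; rewrite leqNgt; apply/negP => lt_N.
pose F t a := t < size L /\ nth 0 L t * q <= a < (nth 0 L t).+1 * q.
pose G b c := c = y * q + b :> nat.
have L_lt z z' : z < z' -> z' < size L -> nth 0 L z < nth 0 L z'.
  move=> lt_z lt_z'; apply: (sorted_ltn_nth ltn_trans) => //.
  - by apply: (sorted_filter ltn_trans); apply: iota_ltn_sorted.
  - by rewrite inE; lia.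
pose A' t b := (t < size L) && [exists a : 'I_q, A (nth 0 L t * q + a) (y * q + b)].
have [|t lt_t lt_s] := sparse A'.
  apply: contra_not noA; apply: (@has_pattern_minor _ _ _ _ _ F G).
  - move=> t t' a a' lt_t [_ Ha] [lt_t' Ha'].
    exact: separated_blocks (L_lt _ _ lt_t lt_t') Ha Ha'.
  - by rewrite /G => b b' c c' lt_b -> ->; rewrite ltn_add2l.
  - move=> t b /andP[lt_t /existsP[a Ha]].
    exists (nth 0 L t * q + a), (y * q + b); split=> //; split=> //.
    have lt_a : a < q := ltn_ord a; nia.
have lt_tL : t < size L by exact: ltn_trans lt_t lt_N.
have : W (nth 0 L t) by have := mem_nth 0 lt_tL; rewrite mem_filter => /andP[].
rewrite /W /wide leqNgt => /negP; apply; apply: leq_ltn_trans lt_s.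
by apply/eq_leq/eq_count => b; rewrite /A' lt_tL.
Qed.

(** A block neither wide nor tall has its 1-entries in fewer than [s] rows and fewer than [s]
    columns. *)
Lemma block_mass (q s : nat) (A : nat -> nat -> bool) x y :
  \sum_(a < q) \sum_(b < q) A (x * q + a) (y * q + b) <=
    s * s * contract q A x y
    + q * q * (wide q s A x y + wide q s (fun a b => A b a) y x).
Proof.
set w := leqLHS.
have le_q : w <= q * q.
  rewrite -[X in _ <= X * _](card_ord q) -sum_nat_const; apply: leq_sum => a _.
  rewrite -[leqRHS](card_ord q) -sum1_card; apply: leq_sum => b _.
  by case: (A _ _).
case: (boolP (wide q s A x y)) => /= [_|nwide]; first by nia.
case: (boolP (wide _ _ _ _ _)) => /= [_|ntall]; first by nia.
have [c|nc] := boolP (contract q A x y); last first.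
  rewrite /= !muln0 addn0 leqn0 /w.
  rewrite big1 // => a _; rewrite big1 // => b _.
  apply/eqP; rewrite eqb0; apply: contra nc => Aab.
  by apply/existsP; exists a; apply/existsP; exists b.
rewrite muln1 addn0 muln0 addn0.
rewrite /wide -!ltnNge in nwide ntall.
apply: leq_trans _ (leq_mul (ltnW ntall) (ltnW nwide)).
rewrite -!sum_bool_count big_distrl /=; apply: leq_sum => a _.
rewrite big_distrr /=; apply: leq_sum => b _.
case Aab: (A _ _) => //=.
have -> : [exists b : 'I_q, A (x * q + a) (y * q + b)] by apply/existsP; exists b.
by have -> : [exists a : 'I_q, A (x * q + a) (y * q + b)] by apply/existsP; exists a.
Qed.

(** Induction through the contraction to side [n']. As [q = 4 s^2], the ordinary blocks and the wide
    or tall ones contribute at most [2 N q (q n')] each, and [q n' <= 2 n]. *)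
Lemma mass_linear (E : Type) (ltr ltc : rel E) (N q s : nat) :
  0 < s -> q = 4 * (s * s) ->
  (forall A, ~ has_pattern ltr ltc A ->
     exists2 t, t < N & count (A t) (iota 0 q) < s) ->
  (forall A, ~ has_pattern ltc ltr A ->
     exists2 t, t < N & count (A t) (iota 0 q) < s) ->
  forall n A, ~ has_pattern ltr ltc A -> mass n n A <= 8 * N * q * n.
Proof.
move=> s_gt0 Eq sparse sparseT n; elim/ltn_ind: n => n IH A noA.
have q_gt3 : 3 < q by nia.
have N_gt0 : 0 < N by have [t] := sparse _ noA; lia.
have [lt_n|le_q] := ltnP n q.
  have : mass n n A <= n * n.
    rewrite -[X in _ <= X * _](card_ord n) -sum_nat_const; apply: leq_sum => a _.
    rewrite -[leqRHS](card_ord n) -sum1_card; apply: leq_sum => b _.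
    by case: (A _ _).
  have : n * n <= q * n by nia.
  nia.
have q_gt0 : 0 < q by lia.
pose n' := (n %/ q).+1.
have le_n : n <= n' * q by rewrite ltnW // ltn_ceil.
have le_n' : q * n' <= 2 * n.
  by rewrite /n' mulnS; have := leq_trunc_div n q; lia.
have lt_n' : n' < n by nia.
have noB : ~ has_pattern ltr ltc (contract q A).
  apply: contra_not noA.
  apply: (@has_pattern_minor _ _ _ _ _ _ _ (separated_blocks q) (separated_blocks q)).
  by move=> x y /contractP.
have {IH noB} := IH n' lt_n' _ noB.
have noT : ~ has_pattern ltc ltr (fun x y => A y x).
  by apply: contra_not noA => /has_pattern_tr.
(* [A] is defined for all indices, so the square can be enlarged to whole blocks. *)
have le1 : mass n n A <= mass (n' * q) (n' * q) A.
  rewrite /mass; apply: leq_trans (_ : _ <= \sum_(x < n) \sum_(y < n' * q) A x y) _.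
    apply: leq_sum => x _.
    rewrite (big_ord_widen _ (fun y => nat_of_bool (A x y)) le_n).
    by rewrite big_mkcond; apply: leq_sum => y _; case: ifP.
  rewrite (big_ord_widen _ (fun x => \sum_(y < n' * q) A x y) le_n).
  by rewrite big_mkcond; apply: leq_sum => y _; case: ifP.
have le2 : mass (n' * q) (n' * q) A <= s * s * mass n' n' (contract q A)
    + q * q * (\sum_(y < n') \sum_(x < n') wide q s A x y
               + \sum_(x < n') \sum_(y < n') wide q s (fun a b => A b a) y x).
  rewrite [X in _ + _ * (X + _)]exchange_big /=.
  rewrite /mass (sum_blocks n' q (fun x => \sum_(y < n' * q) A x y)).
  rewrite -big_split /= !big_distrr /= -big_split /=; apply: leq_sum => x _.
  rewrite -big_split /= !big_distrr /= -big_split /=.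
  under eq_bigr => a _ do
    rewrite (sum_blocks n' q (fun y => nat_of_bool (A (x * q + a) y))).
  rewrite exchange_big /=; apply: leq_sum => y _; exact: block_mass.
have le3 : \sum_(y < n') \sum_(x < n') wide q s A x y <= n' * N.
  rewrite -[X in _ <= X * _](card_ord n') -sum_nat_const; apply: leq_sum => y _.
  exact: wide_blocks sparse noA _ _.
have le4 : \sum_(x < n') \sum_(y < n') wide q s (fun a b => A b a) y x <= n' * N.
  rewrite -[X in _ <= X * _](card_ord n') -sum_nat_const; apply: leq_sum => x _.
  exact: wide_blocks sparseT noT _ _.
move=> le5; apply: leq_trans le1 (leq_trans le2 _).
apply: (@leq_trans (s * s * (8 * N * q * n') + q * q * (n' * N + n' * N))).
  by apply: leq_add; rewrite leq_mul2l ?le5 ?leq_add ?orbT.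
have -> : s * s * (8 * N * q * n') + q * q * (n' * N + n' * N) = 4 * N * q * (q * n').
  by rewrite Eq; nia.
have : 4 * N * q * (q * n') <= 4 * N * q * (2 * n) by rewrite leq_mul2l le_n' orbT.
lia.
Qed.

(** * From finite matrices to patterns *)

Lemma permutation_fun {k : nat} (P : 'M[bool]_k) :
  permutation_matrix P ->
  exists2 pi : 'I_k -> 'I_k, injective pi & forall i a, P i a = (a == pi i).
Proof.
case=> rowP colP; have /choice[pi piP] : forall i, exists a, P i a.
  by move=> i; have [a [Pa _]] := rowP i; exists a.
have P_eq i a : P i a -> a = pi i.
  by have [a' [_ uni]] := rowP i => Pa; rewrite -(uni _ Pa) (uni _ (piP i)).
exists pi => [i i' eq_pi|i a].
  have [i0 [_ uni]] := colP (pi i).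
  by rewrite -(uni _ (piP i)) (uni i') // eq_pi piP.
by apply/idP/eqP => [/P_eq//|->].
Qed.

(** The extension of a finite matrix by zeros. *)
Definition mx_rel {m n : nat} (A : 'M[bool]_(m, n)) (x y : nat) :=
  [exists i : 'I_m, exists j : 'I_n, [&& i == x :> nat, j == y :> nat & A i j]].

Lemma mx_relE m n (A : 'M[bool]_(m, n)) (i : 'I_m) (j : 'I_n) :
  mx_rel A i j = A i j.
Proof.
apply/existsP/idP => [[i' /existsP[j' /and3P[/eqP Hi /eqP Hj]]]|Aij].
  by have -> : i = i' by [exact: val_inj]; have -> // : j = j' by exact: val_inj.
by exists i; apply/existsP; exists j; rewrite !eqxx.
Qed.

Lemma mx_relP m n (A : 'M[bool]_(m, n)) x y :
  reflect (exists i j, [/\ x = val i, y = val j & A i j]) (mx_rel A x y).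
Proof.
apply: (iffP existsP) => [[i /existsP[j /and3P[/eqP<- /eqP<- Aij]]]|[i [j [-> -> Aij]]]].
  by exists i, j.
by exists i; apply/existsP; exists j; rewrite !eqxx.
Qed.

Lemma weight_mass n (A : 'M[bool]_n) : weight A = mass n n (mx_rel A).
Proof.
rewrite /weight cardsE -sum1_card big_mkcond /= /mass pair_big /=.
by apply: eq_bigr => -[i j] _; rewrite mx_relE (_ : _ \in _ = A i j) //; case: (A i j).
Qed.

Lemma contains_grid_product {n k l : nat} (A : 'M[bool]_n)
    (P : 'M[bool]_k) (Q : 'M[bool]_l) (pi : 'I_k -> 'I_k) (rho : 'I_l -> 'I_l) :
  (forall i a, P i a = (a == pi i)) -> (forall j b, Q j b = (b == rho j)) ->
  injective pi -> injective rho ->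
  has_pattern (lex false id id) (lex true pi rho) (mx_rel A) ->
  contains A (grid_product P Q).
Proof.
move=> Ppi Qrho pi_inj rho_inj [u [v [Auv Hu Hv]]].
have /choice[w Hw] : forall e, exists ij : 'I_n * 'I_n,
    [/\ u e = val ij.1, v e = val ij.2 & A ij.1 ij.2].
  by move=> e; have /mx_relP[i [j Aij]] := Auv e; exists (i, j).
have [pi' piK pi'K] := injF_bij pi_inj; have [rho' rhoK rho'K] := injF_bij rho_inj.
have divP m m' r : r < m * m' -> (r %% m < m) && (r %/ m < m').
  case: (posnP m) => [->|m_gt0]; first by rewrite mul0n.
  by rewrite ltn_mod m_gt0 ltn_divLR // mulnC.
have klP (r : 'I_(k * l)) : (r %% k < k) && (r %/ k < l) by apply: divP.
have lkP (c : 'I_(k * l)) : (c %/ l < k) && (c %% l < l).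
  by rewrite andbC; apply: divP; have := ltn_ord c; lia.
(* [er r] and [ec c] are the 1-entries of [P # Q] in row [r] and in column [c]; the embedding is
   read off from them. *)
pose er r : 'I_k * 'I_l :=
  let: conj h1 h2 := andP (klP r) in
    (Ordinal h1, Ordinal h2).
pose ec c : 'I_k * 'I_l :=
  let: conj h1 h2 := andP (lkP c) in (pi' (Ordinal h1), rho' (Ordinal h2)).
have er1 r : (er r).1 = r %% k :> nat by rewrite /er; case: (andP _).
have er2 r : (er r).2 = r %/ k :> nat by rewrite /er; case: (andP _).
have ec1 c : pi (ec c).1 = c %/ l :> nat.
  by rewrite /ec; case: (andP _) => * /=; rewrite pi'K.
have ec2 c : rho (ec c).2 = c %% l :> nat.
  by rewrite /ec; case: (andP _) => * /=; rewrite rho'K.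
exists (fun r => (w (er r)).1), (fun c => (w (ec c)).2); split.
- move=> r r' lt_r; have [<- _ _] := Hw (er r); have [<- _ _] := Hw (er r').
  apply: Hu; rewrite /lex -val_eqE /= !er1 !er2.
  have := divn_eq r k; have := divn_eq r' k; have := leq_div2r k (ltnW lt_r).
  by case: ltngtP => //= [->] _ *; nia.
- move=> c c' lt_c; have [_ <- _] := Hw (ec c); have [_ <- _] := Hw (ec c').
  apply: Hv; rewrite /lex -val_eqE /= !ec1 !ec2.
  have := divn_eq c l; have := divn_eq c' l; have := leq_div2r l (ltnW lt_c).
  by case: ltngtP => //= [->] _ *; nia.
- move=> r c; rewrite !mxE => /existsP[i /existsP[a /existsP[j /existsP[b]]]].
  rewrite Ppi Qrho => /and4P[/eqP Ea /eqP Eb /eqP Er /eqP Ec].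
  have lt_i := ltn_ord i; have lt_b := ltn_ord b.
  have -> : er r = (i, j).
    rewrite [er r]surjective_pairing; congr (_, _); apply: val_inj => /=.
      by rewrite er1 Er modnMDl modn_small.
    by rewrite er2 Er divnMDl ?divn_small ?addn0 //; lia.
  have -> : ec c = (i, j).
    rewrite [ec c]surjective_pairing; congr (_, _).
      apply: pi_inj; apply: val_inj; rewrite /= ec1 Ec -Ea.
      by rewrite divnMDl ?divn_small ?addn0 //; lia.
    by apply: rho_inj; apply: val_inj; rewrite /= ec2 Ec -Eb modnMDl modn_small.
  by case: (Hw (i, j)).
Qed.

Lemma contains_permutation {n l : nat} {A : 'M[bool]_n} {Q : 'M[bool]_l}
    {rho : 'I_l -> 'I_l} :
  (forall j b, Q j b = (b == rho j)) -> injective rho ->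
  contains A Q <->
  has_pattern (fun j j' : 'I_l => j < j') (fun j j' => rho j < rho j') (mx_rel A).
Proof.
move=> Qrho rho_inj; split.
  case=> f [g [Hf Hg HQ]]; exists (fun j => f j), (fun j => g (rho j)); split.
  - by move=> j; rewrite mx_relE; have := HQ j (rho j); rewrite mxE; apply; rewrite Qrho.
  - exact: Hf.
  - by move=> j j'; apply: Hg.
case=> u [v [Auv Hu Hv]].
have /choice[w Hw] : forall e, exists ij : 'I_n * 'I_n,
    [/\ u e = val ij.1, v e = val ij.2 & A ij.1 ij.2].
  by move=> e; have /mx_relP[i [j Aij]] := Auv e; exists (i, j).
have [rho' rhoK rho'K] := injF_bij rho_inj.
exists (fun j => (w j).1), (fun c => (w (rho' c)).2); split.
- by move=> j j' lt_j; have [<- _ _] := Hw j; have [<- _ _] := Hw j'; apply: Hu.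
- move=> c c' lt_c; have [_ <- _] := Hw (rho' c); have [_ <- _] := Hw (rho' c').
  by apply: Hv; rewrite !rho'K.
- move=> j b; rewrite Qrho => /eqP ->; rewrite mxE rhoK.
  by case: (Hw j).
Qed.

Lemma forces_tr b l (beta delta : 'I_l -> 'I_l) :
  forces b beta delta -> forces b delta beta.
Proof.
move=> HQ M HM; have := HQ (fun r y => M y r).
rewrite exchange_big => /(_ HM) /has_pattern_tr.
apply: (@has_pattern_minor _ _ _ _ _ eq eq); try by move=> x x' a a' ? <- <-.
by move=> x y /= ?; exists x, y; split=> //; rewrite andbCA.
Qed.

(** * Extremal numbers and superadditivity *)

Lemma ex_ge_mass {n l : nat} {Q : 'M[bool]_l} {rho : 'I_l -> 'I_l}
    {M : nat -> nat -> bool} :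
  (forall j b, Q j b = (b == rho j)) -> injective rho ->
  ~ has_pattern (fun j j' : 'I_l => j < j') (fun j j' => rho j < rho j')
      (fun x y => [&& x < n, y < n & M x y]) ->
  mass n n M <= ex n Q.
Proof.
move=> Qrho rho_inj noM; pose A : 'M[bool]_n := (\matrix_(i, j) M i j)%R.
have AM x y : mx_rel A x y = [&& x < n, y < n & M x y].
  apply/mx_relP/and3P => [[i [j [-> -> ]]]|[lt_x lt_y Mxy]].
    by rewrite mxE; split=> //; apply: ltn_ord.
  by exists (Ordinal lt_x), (Ordinal lt_y); split; rewrite ?mxE.
have -> : mass n n M = weight A.
  by rewrite weight_mass; do 2![apply: eq_bigr => ? _]; rewrite mx_relE mxE.
apply: leq_bigmax_cond; apply/asboolP => /(contains_permutation Qrho rho_inj).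
apply: contra_not noM; apply: (@has_pattern_minor _ _ _ _ _ eq eq);
  try by move=> x x' a a' ? <- <-.
by move=> x y Axy; exists x, y; rewrite -AM.
Qed.

Lemma forces_ex b l (Q : 'M[bool]_l) (rho : 'I_l -> 'I_l) :
  (forall j b, Q j b = (b == rho j)) -> injective rho ->
  2 * ex b Q < b * b -> forces b id rho.
Proof.
move=> Qrho rho_inj lt_b M HM.
apply: contrapT => noM; have := ex_ge_mass Qrho rho_inj noM.
by rewrite /mass; lia.
Qed.

Lemma ex_attained {n l : nat} (Q : 'M[bool]_l) (rho : 'I_l -> 'I_l) :
  0 < l -> (forall j b, Q j b = (b == rho j)) -> injective rho ->
  exists2 M, ~ has_pattern (fun j j' : 'I_l => j < j') (fun j j' => rho j < rho j') M
    & mass n n M = ex n Q.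
Proof.
move=> l_gt0 Qrho rho_inj.
have [A /asboolP noA exA] : {A | A \in [pred A : 'M[bool]_n | `[< avoids A Q >]]
    & ex n Q = weight A}.
  (* The zero matrix avoids [Q], so the maximum is over a nonempty set. *)
  apply: eq_bigmax_cond; apply/card_gt0P; exists (const_mx false).
  apply/asboolP => -[f [g [_ _ H]]]; have := H (Ordinal l_gt0) (rho (Ordinal l_gt0)).
  by rewrite Qrho eqxx !mxE => /(_ isT).
exists (mx_rel A); last by rewrite exA weight_mass.
by apply: contra_not noA => /(contains_permutation Qrho rho_inj).
Qed.

(* A copy of [Q] meeting two blocks of a block diagonal (antidiagonal) matrix
   has the entry of its last row to the right (left) of that of its first row,
   so one of the two arrangements of [m] optimal matrices avoids [Q]. *)
Lemma ex_superadditive (m n l : nat) (Q : 'M[bool]_l) (rho : 'I_l -> 'I_l) :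
  1 < l -> 0 < n -> (forall j b, Q j b = (b == rho j)) -> injective rho ->
  m * ex n Q <= ex (m * n) Q.
Proof.
move=> l_gt1 n_gt0 Qrho rho_inj; have l_gt0 : 0 < l by lia.
have [M noM exM] := @ex_attained n l Q rho l_gt0 Qrho rho_inj.
pose j0 := Ordinal l_gt0; have lt_l : l.-1 < l by lia.
pose j1 := Ordinal lt_l.
have lt01 : (j0 < j1) by rewrite /=; lia.
(* [s x] is the block column of the block in block row [x]: antidiagonal if [rho] puts the last row
   to the right of the first, diagonal otherwise. *)
pose s (x : nat) := if rho j0 < rho j1 then m.-1 - x else x.
pose M' x y := (s (x %/ n) == y %/ n) && M (x %% n) (y %% n).
have massM' : mass (m * n) (m * n) M' = m * ex n Q.
  rewrite /mass (sum_blocks m n (fun x => \sum_(y < m * n) M' x y)).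
  rewrite -[X in _ = X * _](card_ord m) -sum_nat_const; apply: eq_bigr => x _.
  rewrite -exM; apply: eq_bigr => a _.
  rewrite (sum_blocks m n (fun y => nat_of_bool (M' (x * n + a) y))).
  have lt_s : s x < m by rewrite /s; have := ltn_ord x; case: ifP; lia.
  rewrite (bigD1 (Ordinal lt_s)) //= [X in _ + X]big1 ?addn0 => [|z ne_z].
    apply: eq_bigr => b _.
    by rewrite /M' !divnMDl // !modnMDl !divn_small // !modn_small // !addn0 eqxx.
  rewrite big1 // => b _; rewrite /M' !divnMDl // !divn_small // !addn0.
  by case: eqP => // Ez; case/negP: ne_z; apply/eqP/val_inj.
rewrite -massM'; apply: (ex_ge_mass Qrho rho_inj) => -[u [v [Huv Hu Hv]]].
have Hb j : [/\ u j %/ n < m, s (u j %/ n) = v j %/ n & M (u j %% n) (v j %% n)].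
  have /and4P[lt_u lt_v /eqP -> ->] := Huv j; split=> //.
  by rewrite ltn_divLR.
have le_u (j j' : 'I_l) : j <= j' -> u j <= u j'.
  by rewrite leq_eqVlt => /orP[/eqP/val_inj ->//|/Hu/ltnW].
(* If the first and last rows share a block row, the whole copy lies in one block, hence in [M]. *)
have [eq_u|ne_u] := eqVneq (u j0 %/ n) (u j1 %/ n).
  have const j : u j %/ n = u j0 %/ n.
    apply/eqP; rewrite eqn_leq {1}eq_u !leq_div2r ?le_u //=.
    by have := ltn_ord j; rewrite /=; lia.
  apply: noM; exists (fun j => u j %% n), (fun j => v j %% n); split.
  - by move=> j; case: (Hb j).
  - move=> j j' /Hu; rewrite {1}(divn_eq (u j) n) {1}(divn_eq (u j') n) !const.
    by rewrite ltn_add2l.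
  - have constv j : v j %/ n = v j0 %/ n.
      by have [_ <- _] := Hb j; have [_ <- _] := Hb j0; rewrite const.
    move=> j j' /Hv; rewrite {1}(divn_eq (v j) n) {1}(divn_eq (v j') n) !constv.
    by rewrite ltn_add2l.
have lt_u : u j0 %/ n < u j1 %/ n.
  by rewrite ltn_neqAle ne_u leq_div2r // ltnW // Hu.
have [lt_m1 E1 _] := Hb j1; have [lt_m0 E0 _] := Hb j0.
move: E0 E1; rewrite /s; case: ltnP => [lt_r|le_r] E0 E1.
  by have := leq_div2r n (ltnW (Hv _ _ lt_r)); lia.
have lt_r : rho j1 < rho j0.
  rewrite ltn_neqAle le_r andbT; apply/eqP => /val_inj/rho_inj E.
  by rewrite E ltnn in lt01.
by have := leq_div2r n (ltnW (Hv _ _ lt_r)); lia.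
Qed.

(** * Comparison with the limit constant *)

Local Open Scope ring_scope.

(* The library's [lim] is [0] on a divergent sequence, so no convergence
   is needed here. *)
Lemma limit_const_le (K : realType) (k : nat) (P : 'M[bool]_k) (x : K) :
  0 <= x -> (forall n, (ex n P)%:R <= x * n%:R) -> limit_const K P <= x.
Proof.
move=> x_ge0 Hex; rewrite /limit_const.
have [cv|dv] := pselect (cvgn (fun n => (ex n P)%:R / n%:R : K)).
  apply: limr_le => //; near=> n.
  rewrite ler_pdivrMr ?ltr0n //; near: n; exact: nbhs_infty_gt.
by rewrite (dvgP dv).
Unshelve. all: by end_near. Qed.

(** By superadditivity, no multiple of [n] has a smaller ratio than [n], so the limit is no smaller
    either. Convergence follows from the nonzero value, as a divergent sequence has the default
    limit [0]. *)
Lemma ex_le_limit_const (K : realType) (n l : nat) (Q : 'M[bool]_l) :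
  (1 < l)%N -> permutation_matrix Q -> limit_const K Q != 0 ->
  (ex n Q)%:R <= limit_const K Q * n%:R.
Proof.
move=> l_gt1 /permutation_fun[rho rho_inj Qrho] nz.
have cv : cvgn (fun n => (ex n Q)%:R / n%:R : K).
  by apply: contrapT => dv; case/eqP: nz; rewrite /limit_const (dvgP dv).
have [->|n_gt0] := posnP n.
  rewrite mulr0 lern0 -leqn0; apply/bigmax_leqP => A _.
  by rewrite weight_mass /mass big_ord0.
rewrite -ler_pdivrMr ?ltr0n // leNgt; apply/negP => lt_c.
have [N _ HN] := cvgr_lt _ cv _ lt_c.
have /= := HN (N.+1 * n)%N (leq_trans (leqnSn N) (leq_pmulr _ n_gt0)).
apply/negP; rewrite -leNgt.
rewrite ler_pdivrMr ?ltr0n // mulrAC ler_pdivlMr ?ltr0n ?muln_gt0 ?n_gt0 //.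
rewrite -!natrM ler_nat mulnA leq_mul2r; apply/orP; right.
by rewrite mulnC; apply: (ex_superadditive _ _ _ _ _ l_gt1 n_gt0 Qrho rho_inj).
Qed.

(** * Choice of parameters and the final bound *)

Local Open Scope nat_scope.

Lemma ex_grid_product (k l b m : nat) (P : 'M[bool]_k) (Q : 'M[bool]_l) :
  0 < k -> permutation_matrix P -> permutation_matrix Q ->
  2 * ex b Q < b * b -> 4 * (k * b * (k * b)) < 2 ^ m ->
  forall n, ex n (grid_product P Q)
    <= 8 * (k.*2 * b) ^ (8 * k * m) * (4 * (k * b * (k * b))) * n.
Proof.
move=> k_gt0 /permutation_fun[pi pi_inj Ppi] /permutation_fun[rho rho_inj Qrho].
move=> lt_ex lt_m n; apply/bigmax_leqP => A /asboolP noA.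
have b_gt0 : 0 < b by case: (b) lt_ex.
have HQ : forces b id rho := forces_ex _ _ _ _ Qrho rho_inj lt_ex.
rewrite weight_mass.
apply: (@mass_linear _ (lex false id id) (lex true pi rho) _ _ (k * b)) => //.
- by rewrite muln_gt0 k_gt0.
- by move=> A' noA'; apply: sparse_row noA'.
- move=> A' noA'; apply: sparse_row noA' => //; exact: forces_tr.
- by apply: contra_not noA; apply: contains_grid_product Ppi Qrho pi_inj rho_inj.
Qed.

(** With [b = 2 ^ e.+1] one has [q <= 2 ^ (4 * e + 4)] and [B <= 2 ^ (2 * e + 2)], so
    [m = 4 * e + 5]. The exponent of [N] is at most [288 * k * e ^ 2], and the other factors add at
    most [11 * k * e ^ 2]. *)
Lemma ex_grid_product_exp (k l e : nat) (P : 'M[bool]_k) (Q : 'M[bool]_l) :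
  0 < k -> 0 < e -> k <= 2 ^ e -> permutation_matrix P -> permutation_matrix Q ->
  ex (2 ^ e.+1) Q < 2 ^ e * 2 ^ e.+1 ->
  forall n, ex n (grid_product P Q) <= 2 ^ (300 * k * (e * e)) * n.
Proof.
move=> k_gt0 e_gt0 le_k permP permQ lt_ex n.
have le_s : k * 2 ^ e.+1 <= 2 ^ (e + e.+1) by rewrite expnD leq_mul2r le_k orbT.
have le_q : 4 * (k * 2 ^ e.+1 * (k * 2 ^ e.+1)) <= 2 ^ (2 + (e + e.+1 + (e + e.+1))).
  by rewrite expnD leq_mul2l /= expnD leq_mul.
have le_N : (k.*2 * 2 ^ e.+1) ^ (8 * k * (4 * e + 5))
    <= 2 ^ ((1 + (e + e.+1)) * (8 * k * (4 * e + 5))).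
  rewrite [leqRHS]expnM leq_exp2r ?muln_gt0 ?k_gt0 ?addn_gt0 ?orbT //.
  by rewrite -mul2n -mulnA [leqRHS]expnD leq_mul2l.
apply: leq_trans (@ex_grid_product k l (2 ^ e.+1) (4 * e + 5) P Q k_gt0
                    permP permQ _ _ n) _.
- by rewrite [X in _ < X * _]expnS -mulnA ltn_pmul2l.
- apply: leq_ltn_trans le_q _; rewrite ltn_exp2l //; lia.
rewrite leq_mul2r; apply/orP; right.
apply: (@leq_trans (2 ^ 3 * 2 ^ ((1 + (e + e.+1)) * (8 * k * (4 * e + 5)))
                     * 2 ^ (2 + (e + e.+1 + (e + e.+1))))).
  by apply: leq_mul le_q; apply: leq_mul le_N.
rewrite -!expnD leq_exp2l //.
have le1 : 3 + (2 + (e + e.+1 + (e + e.+1))) <= 11 * (k * (e * e)) by nia.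
have le2 : (1 + (e + e.+1)) * (8 * k * (4 * e + 5)) <= 4 * e * (8 * k * (9 * e)).
  by apply: leq_mul; [lia|rewrite leq_mul2l; apply/orP; right; lia].
have le3 : 4 * e * (8 * k * (9 * e)) = 288 * (k * (e * e)) by lia.
have le4 : 300 * k * (e * e) = 300 * (k * (e * e)) by lia.
lia.
Qed.

Local Open Scope ring_scope.

Theorem theorem5p2 (K : realType) :
  exists C : K, 0 < C /\
    forall (k l : nat) (P : 'M[bool]_k) (Q : 'M[bool]_l),
      (2 <= k)%N -> (2 <= l)%N ->
      permutation_matrix P -> permutation_matrix Q ->
      3 <= limit_const K Q ->
      limit_const K (grid_product P Q)
        <= 2 `^ (C * k%:R * log2 (limit_const K Q * k%:R) ^+ 2).
Proof.
(* The factor [4] comes from [e <= 2 * z] in the exponent [300 * k * e ^ 2]. *)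
exists (300 * 4); split=> [|k l P Q k_ge2 l_ge2 permP permQ].
  by rewrite mulr_gt0 ?ltr0n.
set c := limit_const K Q => c_ge3; set z := log2 (c * k%:R).
have k2 : 2 <= k%:R :> K by rewrite (ler_nat K 2 k).
have c_neq0 : c != 0 by apply: lt0r_neq0; lra.
have ck_gt0 : 0 < c * k%:R by nra.
have ln2_gt0 : 0 < ln 2 :> K by rewrite ln_gt0 // ltr1n.
have powz : 2 `^ z = c * k%:R.
  by rewrite /powR pnatr_eq0 /= /z /log2 divfK ?gt_eqF // lnK.
have z_ge1 : 1 <= z.
  rewrite /z /log2 ler_pdivlMr // mul1r ler_ln ?posrE //; nra.
(* [2 ^ e] exceeds [c * k], hence both [c] and [k]; rounding up at most doubles [z] since
   [z >= 1]. *)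
pose e := (Num.truncn z).+1.
have lt_e : z < e%:R by rewrite /e truncnS_gt //; lra.
have le_e : e%:R <= 2 * z.
  have := truncn_le z; rewrite /e -natr1; lra.
have ck_le : c * k%:R <= 2 ^+ e.
  by rewrite -powz -powR_mulrn // ler_powR ?ler1n // ltW.
have e_gt0 : (0 < e)%N by [].
apply: (@le_trans _ _ (2 ^+ (300 * k * (e * e)))).
  apply: limit_const_le => [|n]; first exact: exprn_ge0.
  rewrite -natrX -natrM ler_nat; apply: ex_grid_product_exp => //; first by lia.
    rewrite -(ler_nat K) natrX; apply: le_trans _ ck_le; nra.
  rewrite -(ltr_nat K) natrM.
  apply: le_lt_trans (ex_le_limit_const K _ _ _ l_ge2 permQ c_neq0) _.
  rewrite ltr_pM2r ?ltr0n ?expn_gt0 // natrX; apply: lt_le_trans ck_le.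
  by rewrite -/c ltr_pMr; lra.
rewrite -[leLHS]powR_mulrn //; apply: ler_powR; first by rewrite ler1n.
rewrite !natrM.
have -> : 300 * 4 * k%:R * z ^+ 2 = 300%:R * k%:R * ((2 * z) * (2 * z)).
  by move: (300%:R) => a; ring.
by apply: ler_wpM2l; [rewrite mulr_ge0 ?ler0n|rewrite ler_pM].
Qed.
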